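(* Let $\Omega\subset\mathbb{R}^n$ be a closed set. Then the projection mapping $P_\Omega\colon\mathbb{R}^n\rightrightarrows\mathbb{R}^n$ is inner calm* at every $\bar x\in\Omega$. Moreover, for every $\bar x\in\Omega$ and every sequence $x_k\to\bar x$ with $x_k\neq\bar x$ for all $k$ and $\operatorname{dist}(x_k,\Omega)/\|x_k-\bar x\|\to 0$, one has, for all choices $y_k\in P_\Omega(x_k)$, $$\frac{y_k-\bar x}{\|x_k-\bar x\|}-\frac{x_k-\bar x}{\|x_k-\bar x\|}\to 0,$$ i.e., along a subsequence, the quotients $(y_k-\bar x)/\|x_k-\bar x\|$ and $(x_k-\bar x)/\|x_k-\bar x\|$ converge to the same vector.
   Context: $\mathbb{R}^n$ carries the Euclidean norm $\|\cdot\|$, and $\operatorname{dist}(x,\Omega):=\inf_{y\in\Omega}\|y-x\|$. The projection mapping is $P_\Omega(x):=\operatorname{argmin}_{y\in\Omega}\|y-x\|$ (a set). A set-valued mapping $\Gamma\colon\mathbb{R}^n\rightrightarrows\mathbb{R}^m$ is called inner calm* at $\bar x\in\operatorname{dom}\Gamma:=\{x\mid\Gamma(x)\neq\varnothing\}$ if there exists $\kappa>0$ such that for each sequence $x_k\to\bar x$ there exist $y\in\mathbb{R}^m$, a subsequence $x_{k_\ell}$ of $x_k$, and a sequence $y_\ell\to y$ with $y_\ell\in\Gamma(x_{k_\ell})$ and $\|y_\ell-y\|\le\kappa\|x_{k_\ell}-\bar x\|$ for each $\ell\in\mathbb{N}$. *)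

(* Defs.v *)
From HB Require Import structures.
From mathcomp Require Import all_boot all_order all_algebra.
From mathcomp Require Import all_classical all_reals all_analysis.

Set Implicit Arguments.
Unset Strict Implicit.
Unset Printing Implicit Defensive.

Import Order.TTheory GRing.Theory Num.Theory.
Import numFieldNormedType.Exports.

Local Open Scope classical_set_scope.
Local Open Scope ring_scope.

(* The library norm `|u| on 'rV[R]_n is the sup norm, so the Euclidean norm is
   defined here. Both induce the same topology: closedness and convergence in
   'rV[R]_n are therefore taken from the library. *)
Definition euclid_norm (R : realType) (n : nat) (u : 'rV[R]_n) : R :=
  Num.sqrt (\sum_(i < n) u ord0 i ^+ 2).

(* A real infimum: meaningful for nonempty Omega only. *)
Definition euclid_dist (R : realType) (n : nat) (x : 'rV[R]_n)
    (Omega : set 'rV[R]_n) : R :=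
  inf [set euclid_norm (y - x) | y in Omega].

Definition euclid_proj (R : realType) (n : nat) (Omega : set 'rV[R]_n)
    (x : 'rV[R]_n) : set 'rV[R]_n :=
  [set y | Omega y /\ forall z, Omega z -> euclid_norm (y - x) <= euclid_norm (z - x)].

Definition svm_dom (R : realType) (n m : nat) (Gamma : 'rV[R]_n -> set 'rV[R]_m) :
    set 'rV[R]_n :=
  [set x | Gamma x !=set0].

(* The indices of a subsequence form a strictly increasing map phi. *)
Definition inner_calm_star (R : realType) (n m : nat)
    (Gamma : 'rV[R]_n -> set 'rV[R]_m) (xbar : 'rV[R]_n) : Prop :=
  svm_dom Gamma xbar /\
  exists2 kappa : R, 0 < kappa &
    forall x : nat -> 'rV[R]_n, x @ \oo --> xbar ->
    exists (y : 'rV[R]_m) (phi : nat -> nat) (y_ : nat -> 'rV[R]_m),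
      [/\ {homo phi : i j / (i < j)%N},
          y_ @ \oo --> y &
          forall l : nat, Gamma (x (phi l)) (y_ l) /\
            euclid_norm (y_ l - y) <= kappa * euclid_norm (x (phi l) - xbar)].

(* Main.v *)
Require Import Defs.
From HB Require Import structures.
From mathcomp Require Import all_boot all_order all_algebra.
From mathcomp Require Import all_classical all_reals all_analysis.
From mathcomp Require Import ring.

Set Implicit Arguments.
Unset Strict Implicit.
Unset Printing Implicit Defensive.

Import Order.TTheory GRing.Theory Num.Theory.
Import numFieldNormedType.Exports.
Local Open Scope classical_set_scope.
Local Open Scope ring_scope.

(** Both halves rest on the minimality of a projection [y] of [x]: the distance
from [x] to [y] is at most the distance from [x] to any point of [Omega], in
particular to [xbar].

For inner calmness*, the triangle inequality turns this into
[|y - xbar| <= 2 |x - xbar|] ([euclid_proj_le]). So any selection of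
projections along a sequence tending to [xbar] tends to [xbar] itself, and the
definition holds with [kappa = 2], limit [xbar], and the whole sequence as the
subsequence. A selection exists because [Omega] is closed and the space is
finite dimensional ([euclid_proj_nonempty]).

For the second half, the difference of the two quotients is
[(y k - x k) / |x k - xbar|], whose norm is exactly the ratio
[dist (x k, Omega) / |x k - xbar|], because a projection realizes the distance
([euclid_dist_proj]). That ratio tends to 0 by hypothesis. The quotients
[(x k - xbar) / |x k - xbar|] are unit vectors, so compactness gives a
convergent subsequence ([compact_cvg_subseq]), along which the other quotients
have the same limit.

Topology is induced by the sup norm [`|u|] while the estimates are Euclidean;
[norm_le_euclid] and [euclid_norm_continuous] pass between the two. *)

Section EuclidNorm.
Context {R : realType} {n : nat}.
Implicit Types (u v : 'rV[R]_n) (a : R).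

Lemma euclid_norm_ge0 u : 0 <= euclid_norm u.
Proof. exact: sqrtr_ge0. Qed.

Lemma sqr_euclid_norm u : euclid_norm u ^+ 2 = \sum_(i < n) u ord0 i ^+ 2.
Proof. by rewrite sqr_sqrtr// sumr_ge0// => i _; rewrite sqr_ge0. Qed.

Lemma euclid_normN u : euclid_norm (- u) = euclid_norm u.
Proof.
by congr Num.sqrt; apply: eq_bigr => i _; rewrite mxE sqrrN.
Qed.

Lemma euclid_distC u v : euclid_norm (u - v) = euclid_norm (v - u).
Proof. by rewrite -euclid_normN opprB. Qed.

Lemma euclid_norm0 : euclid_norm (0 : 'rV[R]_n) = 0.
Proof.
by rewrite /euclid_norm big1 ?sqrtr0// => i _; rewrite mxE expr0n.
Qed.

Lemma euclid_normZ a u : euclid_norm (a *: u) = `|a| * euclid_norm u.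
Proof.
rewrite -sqrtr_sqr -sqrtrM ?sqr_ge0//; congr Num.sqrt.
by rewrite mulr_sumr; apply: eq_bigr => i _; rewrite mxE exprMn.
Qed.

Lemma norm_le_euclid u : `|u| <= euclid_norm u.
Proof.
rewrite [leLHS]/Num.norm/= mx_normrE; apply/bigmax_leP.
split=> [|[i j] _ /=]; first exact: euclid_norm_ge0.
rewrite (ord1 i) -sqrtr_sqr ler_wsqrtr// (bigD1 j)//= lerDl.
by apply: sumr_ge0 => k _; rewrite sqr_ge0.
Qed.

Lemma euclid_norm_gt0 u : u != 0 -> 0 < euclid_norm u.
Proof. by rewrite -normr_gt0 => /lt_le_trans; apply; exact: norm_le_euclid. Qed.

(** Weighting the inequality of arithmetic and geometric means by the norms
[a] of [u] and [b] of [v], [2 u_i v_i <= (b / a) u_i ^ 2 + (a / b) v_i ^ 2],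
and summing over [i] gives the triangle inequality without a separate proof of
the Cauchy-Schwarz inequality. *)
Lemma euclid_normD u v : euclid_norm (u + v) <= euclid_norm u + euclid_norm v.
Proof.
have [->|/euclid_norm_gt0] := eqVneq u 0; first by rewrite add0r euclid_norm0 add0r.
have [->|/euclid_norm_gt0] := eqVneq v 0; first by rewrite addr0 euclid_norm0 addr0.
set a := euclid_norm u; set b := euclid_norm v => b0 a0.
rewrite -(@ler_pXn2r _ 2)// ?nnegrE ?addr_ge0 ?euclid_norm_ge0//.
rewrite sqr_euclid_norm.
apply: (@le_trans _ _ (\sum_(i < n) ((1 + b / a) * u ord0 i ^+ 2
                                    + (1 + a / b) * v ord0 i ^+ 2))).
  apply: ler_sum => i _; rewrite mxE -subr_ge0.
  set p := u ord0 i; set q := v ord0 i.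
  rewrite [leRHS](_ : _ = (b * p - a * q) ^+ 2 / (a * b)); last first.
    by field; rewrite !gt_eqF.
  by rewrite divr_ge0 ?sqr_ge0// mulr_ge0// ltW.
rewrite big_split/= -!mulr_sumr -!sqr_euclid_norm -/a -/b.
by rewrite le_eqVlt; apply/orP; left; apply/eqP; field; rewrite !gt_eqF.
Qed.

Lemma euclid_norm_continuous : continuous (@euclid_norm R n).
Proof.
move=> u; apply: continuous_comp; last exact: sqrt_continuous.
apply: (@cvg_big _ _ _ _ _ _ _ (nbhs u)) => [|i _]; first exact: add_continuous.
apply: (@continuous_comp _ _ _ (fun v : 'rV[R]_n => v ord0 i) (fun t : R => t ^+ 2)).
  exact: coord_continuous.
exact: exprn_continuous.
Qed.

Lemma cvg_euclid0 (w : nat -> 'rV[R]_n) :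
  euclid_norm (w k) @[k --> \oo] --> (0 : R) -> w @ \oo --> (0 : 'rV[R]_n).
Proof.
move=> w0; apply: norm_cvg0; apply: (squeeze_cvgr _ (cvg_cst 0) w0).
by near=> k; rewrite normr_ge0 norm_le_euclid.
Unshelve. all: end_near. Qed.

End EuclidNorm.

(** Compactness gives a cluster point [v] of the sequence [u] in [V]. To extract
a subsequence, it suffices to look at the real sequence [`|u k - v|], of which
0 is then a cluster point: the real case [cluster_eventually_cvg] applies. *)
Lemma compact_cvg_subseq {R : realType} {V : normedModType R} (A : set V)
    (u : nat -> V) : compact A -> (forall k, A (u k)) ->
  exists phi (v : V), {homo phi : i j / (i < j)%N} /\ u (phi k) @[k --> \oo] --> v.
Proof.
move=> cA Au.
have [v [_ uv]] : A `&` cluster (u @ \oo) !=set0.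
  by apply: cA; exists 0 => // k _; exact: Au.
have /cluster_eventually_cvg[phi phi_incr phi0] :
    cluster (`|u k - v| @[k --> \oo]) 0.
  apply/cluster_eventuallyP => e N e0.
  have uN : (u @ \oo) [set u k | k in [set k | (N <= k)%N]].
    by exists N => // k Nk; exists k.
  have [_ [[k Nk <-] /= vuk]] := uv _ _ uN (nbhsx_ballx v e e0).
  exists k => //; rewrite sub0r normrN normr_id distrC.
  by move: vuk; rewrite -ball_normE => /ltW.
exists phi, v; split; first by move=> i j; rewrite (leqW_mono phi_incr).
by apply/subr_cvg0; apply: norm_cvg0; exact: phi0.
Qed.

Section Projection.
Context {R : realType} {n : nat} (Omega : set 'rV[R]_n).

(** Only the points of [Omega] at most as far from [x] as a fixed [z] in [Omega]
compete for the minimum. They form a closed bounded, hence compact, set, on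
which the continuous distance to [x] attains its minimum. *)
Lemma euclid_proj_nonempty (x : 'rV[R]_n) :
  closed Omega -> Omega !=set0 -> euclid_proj Omega x !=set0.
Proof.
move=> clO [z Oz].
pose f (y : 'rV[R]_n) := euclid_norm (y - x).
have cf : continuous f.
  move=> y; apply: (@continuous_comp _ _ _ (fun y : 'rV[R]_n => y - x));
    last exact: euclid_norm_continuous.
  exact: (@cvgB _ _ _ (nbhs y) _ id (cst x) y x cvg_id (cvg_cst x)).
pose A := Omega `&` f @^-1` [set r | r <= f z].
have Az : A z by split => //=.
have cA : compact A.
  apply: bounded_closed_compact.
    exists (f z + `|x|); split; first by rewrite num_real.
    move=> M ltM y [_ /= yz]; rewrite -(subrK x y).
    rewrite (le_trans (ler_normD _ _))// (le_trans _ (ltW ltM))// lerD2r.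
    exact: le_trans (norm_le_euclid _) yz.
  apply: closedI => //; apply: preimage_closed; last exact: closed_le.
  by move=> y _; exact: cf.
have [y yA miny] := EVT_min_rV (ex_intro _ z Az) cA (continuous_subspaceT cf).
move: yA; rewrite inE => -[Oy yz]; exists y; split => // t Ot.
have [tz|/ltW zt] := leP (f t) (f z); last exact: le_trans zt.
by apply: miny; rewrite inE.
Qed.

Lemma euclid_dist_proj (x y : 'rV[R]_n) :
  euclid_proj Omega x y -> euclid_dist x Omega = euclid_norm (y - x).
Proof.
move=> [Oy miny]; set D := [set euclid_norm (z - x) | z in Omega].
have lbD : lbound D (euclid_norm (y - x)) by move=> _ [z Oz <-]; exact: miny.
apply/eqP; rewrite eq_le; apply/andP; split.
  by apply: ge_inf; [exists (euclid_norm (y - x))|exists y].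
by apply: lb_le_inf => //; exists (euclid_norm (y - x)), y.
Qed.

(** From [xbar] to [y] through [x]: the leg from [x] to [y] is no longer than
the one from [x] to [xbar], since [xbar] competes in the minimum. *)
Lemma euclid_proj_le (xbar x y : 'rV[R]_n) : Omega xbar ->
  euclid_proj Omega x y -> euclid_norm (y - xbar) <= 2 * euclid_norm (x - xbar).
Proof.
move=> Oxbar [_ miny]; rewrite -(subrKA x) mulr_natl mulr2n.
rewrite (le_trans (euclid_normD _ _))// lerD2r.
by rewrite (euclid_distC x) miny.
Qed.

Lemma euclid_proj_inner_calm (xbar : 'rV[R]_n) :
  closed Omega -> Omega xbar -> inner_calm_star (euclid_proj Omega) xbar.
Proof.
move=> clO Oxbar.
have O0 : Omega !=set0 by exists xbar.
split; first exact: euclid_proj_nonempty.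
exists 2 => // x xxbar.
have [y yP] := choice (fun l => euclid_proj_nonempty (x l) clO O0).
have yle l := euclid_proj_le Oxbar (yP l).
exists xbar, id, y; split => //.
apply/subr_cvg0; apply: cvg_euclid0.
have xxbar0 : 2 * euclid_norm (x l - xbar) @[l --> \oo] --> (0 : R).
  rewrite -(mulr0 2) -(@euclid_norm0 R n).
  apply: cvgM; first exact: cvg_cst.
  apply: (@cvg_comp _ _ _ (fun l => x l - xbar) (@euclid_norm R n)).
    exact/subr_cvg0.
  exact: euclid_norm_continuous.
apply: (squeeze_cvgr _ (cvg_cst 0) xxbar0).
by near=> l; rewrite euclid_norm_ge0 yle.
Unshelve. all: end_near. Qed.

End Projection.

Theorem proposition2p2 (R : realType) (n : nat) (Omega : set 'rV[R]_n)
    (Omega_closed : closed Omega) :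
  (forall xbar : 'rV[R]_n, Omega xbar -> inner_calm_star (euclid_proj Omega) xbar) /\
  (forall (xbar : 'rV[R]_n) (x : nat -> 'rV[R]_n),
     Omega xbar ->
     x @ \oo --> xbar ->
     (forall k : nat, x k <> xbar) ->
     (fun k : nat => euclid_dist (x k) Omega / euclid_norm (x k - xbar)) @ \oo --> (0 : R) ->
     forall y : nat -> 'rV[R]_n,
       (forall k : nat, euclid_proj Omega (x k) (y k)) ->
       ((fun k : nat => (euclid_norm (x k - xbar))^-1 *: (y k - xbar)
                        - (euclid_norm (x k - xbar))^-1 *: (x k - xbar))
          @ \oo --> (0 : 'rV[R]_n)) /\
       (exists (phi : nat -> nat) (v : 'rV[R]_n),
          [/\ {homo phi : i j / (i < j)%N},
              (fun l : nat => (euclid_norm (x (phi l) - xbar))^-1 *: (y (phi l) - xbar))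
                @ \oo --> v &
              (fun l : nat => (euclid_norm (x (phi l) - xbar))^-1 *: (x (phi l) - xbar))
                @ \oo --> v])).
Proof.
split=> [xbar|xbar x Oxbar _ xneq dist0 y yP]; first exact: euclid_proj_inner_calm.
pose r k := euclid_norm (x k - xbar).
have r0 k : 0 < r k by apply: euclid_norm_gt0; rewrite subr_eq0; apply/eqP.
pose p k := (r k)^-1 *: (y k - xbar); pose q k := (r k)^-1 *: (x k - xbar).
have pq0 : (fun k => p k - q k) @ \oo --> (0 : 'rV[R]_n).
  apply: cvg_euclid0; apply: cvg_trans dist0; apply: near_eq_cvg; near=> k.
  (* The base point cancels: p k - q k = (r k)^-1 *: (y k - x k). *)
  rewrite (euclid_dist_proj (yP k)) -scalerBr opprB addrA subrK euclid_normZ.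
  by rewrite gtr0_norm ?invr_gt0// mulrC.
split=> //.
have q_le1 k : `|q k| <= 1.
  rewrite (le_trans (norm_le_euclid _))// euclid_normZ gtr0_norm ?invr_gt0//.
  by rewrite mulVf ?gt_eqF.
have cB : compact [set u : 'rV[R]_n | `|u| <= 1].
  apply: bounded_closed_compact.
    by exists 1; split; [exact: num_real|move=> M M1 u /= /le_trans; apply; exact: ltW].
  apply: (@preimage_closed _ _ (fun u : 'rV[R]_n => `|u|) [set t : R | t <= 1]);
    last exact: closed_le.
  by move=> u _; exact: norm_continuous.
have [phi [v [phi_incr qv]]] := compact_cvg_subseq cB q_le1.
exists phi, v; split=> //.
have phi_oo : phi @ \oo --> \oo.
  have le_phi l : (l <= phi l)%N.
    by elim: l => // l /leq_ltn_trans; apply; exact: phi_incr.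
  apply/cvgnyPge => N; near=> l; apply: leq_trans (le_phi l).
  by near: l; exact: nbhs_infty_ge.
apply: (@cvg_sub0 _ _ _ _ _ (p \o phi) (q \o phi)) => //.
exact: cvg_comp phi_oo pq0.
Unshelve. all: end_near. Qed.
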